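(* For any matroid $\mathcal{M}=(E,\mathcal{I})$ with (unweighted) rank function $r=r_{\mathbf{1}}$, $$\inf_{w\in\mathbb{R}_+^E}\mathcal{CG}(r_w)=\mathcal{CG}(r).$$
   Context: Matroids are on a finite ground set. For a matroid $\mathcal{M}=(E,\mathcal{I})$ and weights $w\in\mathbb{R}_+^E$, the weighted matroid rank function is $r_w(S)=\max\{w(T): T\subseteq S,\ T\in\mathcal{I}\}$, where $w(T)=\sum_{i\in T}w_i$; for $w=\mathbf{1}$ (all ones) this is the usual rank function $r$. For $f\colon 2^E\to\mathbb{R}_+$ and $x\in[0,1]^E$, the multilinear extension is $F(x)=\sum_{S\subseteq E}f(S)\prod_{i\in S}x_i\prod_{i\notin S}(1-x_i)$, and the concave extension is $\hat f(x)=\max\{\sum_{S\subseteq E}\lambda_S f(S): \sum_{S\ni i}\lambda_S=x_i\ \forall i\in E,\ \sum_{S\subseteq E}\lambda_S=1,\ \lambda\ge0\}$. The correlation gap of $f$ is $\mathcal{CG}(f)=\inf_{x\in[0,1]^E}F(x)/\hat f(x)$, with the convention $0/0=1$. *)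

(* Defs.v *)
From mathcomp Require Import all_boot all_order all_algebra.
From mathcomp Require Import classical_sets reals.

Set Implicit Arguments.
Unset Strict Implicit.
Unset Printing Implicit Defensive.

Import Order.TTheory GRing.Theory Num.Theory.

Local Open Scope classical_set_scope.
Local Open Scope ring_scope.

Record matroid (E : finType) := Matroid {
  indep : pred {set E};
  indep0 : indep finset.set0;
  indepS : forall A B : {set E}, A \subset B -> indep B -> indep A;
  indep_augment : forall A B : {set E}, indep A -> indep B ->
    (#|A| < #|B|)%N -> exists2 e, e \in B :\: A & indep (e |: A)
}.

Section CorrelationGap.
Variables (R : realType) (E : finType).

(* The default value 0 of the iterated maximum is harmless for w >= 0: it is
   the weight of the independent set T = set0. *)
Definition weighted_rank (M : matroid E) (w : E -> R) (S : {set E}) : R :=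
  \big[Num.max/0]_(T : {set E} | (T \subset S) && indep M T)
    \sum_(i in T) w i.

Definition matroid_rank (M : matroid E) : {set E} -> R := weighted_rank M (fun=> 1).

Definition unit_cube : set (E -> R) :=
  [set x | forall i, 0 <= x i <= 1].

Definition nonneg_weights : set (E -> R) :=
  [set w | forall i, 0 <= w i].

Definition multilinear_ext (f : {set E} -> R) (x : E -> R) : R :=
  \sum_(S : {set E})
    f S * (\prod_(i in S) x i) * (\prod_(i in ~: S) (1 - x i)).

Definition convex_decomp (x : E -> R) : set ({set E} -> R) :=
  [set lam | [/\ forall i, \sum_(S : {set E} | i \in S) lam S = x i,
                 \sum_(S : {set E}) lam S = 1
               & forall S, 0 <= lam S]].

(* For x in the unit cube the supremum is a maximum: convex_decomp x is then a
   nonempty compact polytope and the objective is linear in lam. *)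
Definition concave_ext (f : {set E} -> R) (x : E -> R) : R :=
  sup [set \sum_(S : {set E}) lam S * f S | lam in convex_decomp x].

(* Division with the convention 0 / 0 = 1. The junk case a / 0 = 0 with a != 0
   never arises below for f >= 0, as 0 <= multilinear_ext f x <= concave_ext f x
   on the unit cube. *)
Definition ratio (a b : R) : R :=
  if (a == 0) && (b == 0) then 1 else a / b.

(* The real-valued inf is the genuine infimum when f >= 0: the set of ratios is
   nonempty and bounded below by 0. *)
Definition correlation_gap (f : {set E} -> R) : R :=
  inf [set ratio (multilinear_ext f x) (concave_ext f x) | x in unit_cube].

End CorrelationGap.

Arguments matroid_rank R {E} M S.
Arguments nonneg_weights R E : clear implicits.

(* Main.v *)
Require Import Defs.
From mathcomp Require Import all_boot all_order all_algebra.
From mathcomp Require Import classical_sets reals.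
From mathcomp Require Import boolp.

(** Let [cg] be the correlation gap of the rank function [r].  Since the all-ones
    weight is among the weights, only [cg <= correlation_gap r_w] has content,
    for every [w >= 0].

    The reason is that [r_w] is a nonnegative combination of restrictions of
    [r].  If [A] is the support of [w] and [m > 0] its least value there, the
    greedy property of matroids gives
    [r_w S = r_v S + m * r (S :&: A)] with [v = w - m * 1_A]
    ([weighted_rank_peel]), and [v] has a strictly smaller support.

    The two extensions behave differently, but both favourably, under this
    decomposition.  The multilinear extension [F] is the expectation over the
    random set that contains each [i] independently with probability [x i]; it
    is linear in the function, and intersecting that random set with [A] amounts
    to setting [x] to zero off [A], so the second summand contributes exactly
    [m * F_r (x restricted to A)] ([multilinear_ext_setI]).  The concave
    extension maximizes over all random sets with marginals [x]; a maximizer for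
    the sum need not be one for the summands, so it is only subadditive, and the
    second summand contributes at most [m] times the concave extension of [r] at
    the restricted point ([concave_ext_setI_le]).  As [cg * concave_ext r y]
    is at most [F_r y] at every point [y] of the cube, in particular at the
    restricted one, summing the layers gives
    [cg * concave_ext r_w x <= F_{r_w} x] ([gap_weighted_rank]). *)

Import Order.TTheory GRing.Theory Num.Theory.

Set Implicit Arguments.
Unset Strict Implicit.
Unset Printing Implicit Defensive.

Local Open Scope classical_set_scope.
Local Open Scope ring_scope.

(** * Distributions on subsets *)

Section Extensions.
Context {R : realType} {E : finType}.
Implicit Types (f g : {set E} -> R) (lam : {set E} -> R) (x : E -> R).
Implicit Types (A S T : {set E}).

Definition independent_dist x S : R :=
  \prod_i (if i \in S then x i else 1 - x i).

(** The law of [S :&: A] when [S] has law [lam]. *)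
Definition law_setI A lam T : R := \sum_(S : {set E} | S :&: A == T) lam S.

Definition restrict A x (i : E) : R := if i \in A then x i else 0.

Lemma multilinear_extE f x :
  multilinear_ext f x = \sum_(S : {set E}) independent_dist x S * f S.
Proof.
apply: eq_bigr => S _; rewrite -mulrA mulrC; congr (_ * _).
rewrite /independent_dist [RHS](bigID (mem S)) /=; congr (_ * _).
  by apply: eq_bigr => i ->.
by apply: eq_big => [i|i]; rewrite inE // => /negbTE ->.
Qed.

Lemma sum_law_setI A lam (P : pred {set E}) f :
  \sum_(T : {set E} | P T) law_setI A lam T * f T =
  \sum_(S : {set E} | P (S :&: A)) lam S * f (S :&: A).
Proof.
rewrite [RHS](partition_big (fun S => S :&: A) P) //=.
apply: eq_bigr => T PT; rewrite mulr_suml; apply: eq_big => [S|S /eqP -> //].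
by apply/idP/idP => [/eqP SA|/andP[]//]; rewrite SA PT eqxx.
Qed.

(** Membership of [i] in [S :&: A] is decided coordinate by coordinate, so the
    coordinates of the intersection are again independent. *)
Lemma law_setI_independent A x T :
  law_setI A (independent_dist x) T = independent_dist (restrict A x) T.
Proof.
pose a i : R := ((i \in A) == (i \in T))%:R * x i.
pose b i : R := (i \notin T)%:R * (1 - x i).
(* [a] and [b] are the factors of independent_dist, killed when the choice made
   at [i] is incompatible with [S :&: A = T]; distributivity then sums them. *)
transitivity (\prod_i (a i + b i)); last first.
  apply: eq_bigr => i _; rewrite /a /b /restrict.
  by case: (i \in A); case: (i \in T) => /=;
    rewrite ?mul1r ?mul0r ?addr0 ?add0r ?subr0 // addrC subrK.
rewrite [RHS]bigA_distr /law_setI big_mkcond /=; apply: eq_bigr => S _.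
case: eqP => [SA|neq].
  apply: eq_bigr => i _; rewrite /a /b -SA inE.
  by case: (i \in S); rewrite ?eqxx ?mul1r.
have /existsP[i ne_i] : [exists i, (i \in S :&: A) != (i \in T)].
  rewrite -negb_forall; apply/negP => /forallP eqST; apply: neq.
  by apply/setP => i; apply/eqP.
rewrite (bigD1 i) //=; move: ne_i; rewrite /a /b inE.
by case: (i \in S); case: (i \in A); case: (i \in T) => //= _; rewrite !mul0r.
Qed.

Lemma convex_decomp_setI A lam x :
  convex_decomp x lam -> convex_decomp (restrict A x) (law_setI A lam).
Proof.
move=> [marg tot ge0].
have sumE P : \sum_(T : {set E} | P T) law_setI A lam T =
    \sum_(S : {set E} | P (S :&: A)) lam S.
  have := sum_law_setI A lam P (fun=> 1).
  by under eq_bigr do rewrite mulr1; under [RHS]eq_bigr do rewrite mulr1.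
split=> [i||T]; last exact: sumr_ge0.
- rewrite (sumE (fun T => i \in T)) /restrict.
  case: ifPn => iA; last by rewrite big_pred0 // => S; rewrite inE (negbTE iA) andbF.
  by rewrite -[RHS]marg; apply: eq_bigl => S; rewrite inE iA andbT.
- by rewrite (sumE xpredT).
Qed.

Lemma restrict_unit_cube A x : unit_cube x -> unit_cube (restrict A x).
Proof. by move=> x01 i; rewrite /restrict; case: ifP => // _; rewrite lexx ler01. Qed.

(** The total mass and the marginals are the laws of [S :&: set0] and of
    [S :&: [set i]], which are again independent and trivial to evaluate. *)
Lemma convex_decomp_independent x :
  unit_cube x -> convex_decomp x (independent_dist x).
Proof.
move=> x01; split=> [i||S].
- transitivity (law_setI [set i]%SET (independent_dist x) [set i]%SET).
    apply: eq_bigl => S; rewrite finset.setIC; apply/idP/eqP => [iS|/setP/(_ i)].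
      by apply/finset.setIidPl; rewrite finset.sub1set.
    by rewrite !inE eqxx.
  rewrite law_setI_independent /independent_dist /restrict (bigD1 i) //=.
  rewrite finset.set11 big1 ?mulr1 // => j ji.
  by rewrite finset.in_set1 (negbTE ji) subr0.
- transitivity (law_setI finset.set0 (independent_dist x) finset.set0).
    by apply: eq_bigl => S; rewrite finset.setI0 eqxx.
  rewrite law_setI_independent /independent_dist big1 // => i _.
  by rewrite /restrict !inE subr0.
- apply: prodr_ge0 => i _; have /andP[x0 x1] := x01 i.
  by case: ifP => _ //; rewrite subr_ge0.
Qed.

(** * The multilinear and the concave extension *)

Lemma multilinear_extD f g x :
  multilinear_ext (fun S => f S + g S) x =
  multilinear_ext f x + multilinear_ext g x.
Proof.
by rewrite !multilinear_extE -big_split; apply: eq_bigr => S _; rewrite mulrDr.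
Qed.

Lemma multilinear_extZ (m : R) f x :
  multilinear_ext (fun S => m * f S) x = m * multilinear_ext f x.
Proof.
by rewrite !multilinear_extE mulr_sumr; apply: eq_bigr => S _; rewrite mulrCA.
Qed.

Lemma multilinear_ext_setI A f x :
  multilinear_ext (fun S => f (S :&: A)) x = multilinear_ext f (restrict A x).
Proof.
rewrite !multilinear_extE -(sum_law_setI A _ xpredT).
by apply: eq_bigr => T _; rewrite law_setI_independent.
Qed.

Lemma multilinear_ext_ge0 f x : unit_cube x -> (forall S, 0 <= f S) ->
  0 <= multilinear_ext f x.
Proof.
move=> /convex_decomp_independent[_ _ p0] f0; rewrite multilinear_extE.
by apply: sumr_ge0 => S _; rewrite mulr_ge0.
Qed.

Lemma le_concave_ext f x lam :
  convex_decomp x lam -> \sum_(S : {set E}) lam S * f S <= concave_ext f x.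
Proof.
move=> dec; apply: ub_le_sup; last by exists lam.
(* A weight of total mass 1 cannot exceed 1, whence a bound free of [lam]. *)
exists (\sum_(S : {set E}) `|f S|) => _ [mu [_ tot mu0] <-].
apply: ler_sum => S _; apply: le_trans (ler_norm _) _.
rewrite normrM ger0_norm // ler_piMl // -tot (bigD1 S) //= lerDl.
exact: sumr_ge0.
Qed.

Lemma concave_ext_le f x (B : R) : unit_cube x ->
  (forall lam, convex_decomp x lam -> \sum_(S : {set E}) lam S * f S <= B) ->
  concave_ext f x <= B.
Proof.
move=> /convex_decomp_independent px ub; apply: ge_sup.
  by eexists; exists (independent_dist x).
by move=> _ [lam dec <-]; exact: ub.
Qed.

Lemma multilinear_le_concave f x :
  unit_cube x -> multilinear_ext f x <= concave_ext f x.
Proof.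
by move=> /convex_decomp_independent px; rewrite multilinear_extE le_concave_ext.
Qed.

Lemma concave_extD_le f g x : unit_cube x ->
  concave_ext (fun S => f S + g S) x <= concave_ext f x + concave_ext g x.
Proof.
move=> x01; apply: concave_ext_le => // lam dec.
under eq_bigr do rewrite mulrDr.
by rewrite big_split lerD // le_concave_ext.
Qed.

Lemma concave_extZ_le (m : R) f x : unit_cube x -> 0 <= m ->
  concave_ext (fun S => m * f S) x <= m * concave_ext f x.
Proof.
move=> x01 m0; apply: concave_ext_le => // lam dec.
under eq_bigr do rewrite mulrCA.
by rewrite -mulr_sumr ler_wpM2l // le_concave_ext.
Qed.

Lemma concave_ext_setI_le A f x : unit_cube x ->
  concave_ext (fun S => f (S :&: A)) x <= concave_ext f (restrict A x).
Proof.
move=> x01; apply: concave_ext_le => // lam dec.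
rewrite -(sum_law_setI A lam xpredT f).
apply: le_concave_ext; exact: convex_decomp_setI.
Qed.

(** * Correlation gap *)

Lemma ratio_ge0 (a b : R) : 0 <= a -> 0 <= b -> 0 <= Defs.ratio a b.
Proof. by move=> a0 b0; rewrite /Defs.ratio; case: ifP => // _; rewrite divr_ge0. Qed.

Lemma ratio_le1 (a b : R) : 0 <= a -> a <= b -> Defs.ratio a b <= 1.
Proof.
move=> a0 ab; rewrite /Defs.ratio; case: ifP => // _.
have [b0|b0] := ltP 0 b; first by rewrite ler_pdivrMr // mul1r.
have -> : a = 0 by apply/eqP; rewrite eq_le a0 (le_trans ab b0).
by rewrite mul0r ler01.
Qed.

Section NonnegativeFunction.
Variable f : {set E} -> R.
Hypothesis f_ge0 : forall S, 0 <= f S.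

Let F_ge0 x : unit_cube x -> 0 <= multilinear_ext f x.
Proof. by move=> x01; exact: multilinear_ext_ge0. Qed.

Let fhat_ge0 x : unit_cube x -> 0 <= concave_ext f x.
Proof. by move=> x01; exact: le_trans (F_ge0 x01) (multilinear_le_concave _ x01). Qed.

Lemma correlation_gap_le_ratio x : unit_cube x ->
  correlation_gap f <= Defs.ratio (multilinear_ext f x) (concave_ext f x).
Proof.
move=> x01; apply: ge_inf; last by exists x.
by exists 0 => _ [y y01 <-]; apply: ratio_ge0; [exact: F_ge0|exact: fhat_ge0].
Qed.

Lemma unit_cube0 : unit_cube (fun _ : E => 0 : R).
Proof. by move=> i; rewrite lexx ler01. Qed.

Lemma correlation_gap_ge0 : 0 <= correlation_gap f.
Proof.
apply: lb_le_inf; first by eexists; exists (fun=> 0) => //; exact: unit_cube0.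
by move=> _ [y y01 <-]; apply: ratio_ge0; [exact: F_ge0|exact: fhat_ge0].
Qed.

Lemma correlation_gap_le1 : correlation_gap f <= 1.
Proof.
apply: le_trans (correlation_gap_le_ratio unit_cube0) _.
by apply: ratio_le1; [exact: F_ge0 unit_cube0|exact: multilinear_le_concave unit_cube0].
Qed.

Lemma correlation_gap_mul_le x : unit_cube x ->
  correlation_gap f * concave_ext f x <= multilinear_ext f x.
Proof.
move=> x01; have := correlation_gap_le_ratio x01; rewrite /Defs.ratio.
have [->|nz] := eqVneq (concave_ext f x) 0; first by rewrite mulr0 F_ge0.
by rewrite andbF ler_pdivlMr // lt0r nz fhat_ge0.
Qed.

(** The bound [c <= 1] accounts for the points where both extensions vanish. *)
Lemma le_correlation_gap (c : R) : c <= 1 ->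
  (forall x, unit_cube x -> c * concave_ext f x <= multilinear_ext f x) ->
  c <= correlation_gap f.
Proof.
move=> c1 le_c; apply: lb_le_inf.
  by eexists; exists (fun=> 0) => //; exact: unit_cube0.
move=> _ [x x01 <-]; rewrite /Defs.ratio; case: ifPn => // nz.
have fhat_gt0 : 0 < concave_ext f x.
  rewrite lt0r fhat_ge0 // andbT; apply: contra nz => /eqP fhat0.
  by rewrite fhat0 eqxx andbT eq_le F_ge0 // -fhat0 multilinear_le_concave.
by rewrite ler_pdivlMr // le_c.
Qed.

End NonnegativeFunction.

(** * Weighted rank functions *)

Variable M : matroid E.
Implicit Types (w v : E -> R).

Local Notation rank := (matroid_rank R M).

Lemma weighted_rank_ge0 w S : 0 <= weighted_rank M w S.
Proof. exact: bigmax_ge_id. Qed.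

Lemma le_weighted_rank w S T : T \subset S -> indep M T ->
  \sum_(i in T) w i <= weighted_rank M w S.
Proof.
by move=> TS iT; apply: (le_bigmax_cond _ (fun T : {set E} => \sum_(i in T) w i));
  rewrite TS.
Qed.

Lemma weighted_rank_attained w S : (forall i, 0 <= w i) ->
  exists T, [/\ T \subset S, indep M T & weighted_rank M w S = \sum_(i in T) w i].
Proof.
move=> w0; rewrite /weighted_rank.
have [||T /andP[TS iT] ->] := @eq_bigmax _ _ _ 0 finset.set0
  (fun T : {set E} => (T \subset S) && indep M T)
  (fun T : {set E} => \sum_(i in T) w i).
- by rewrite finset.sub0set indep0.
- by move=> T _; apply: sumr_ge0.
- by exists T.
Qed.

Lemma indep_extend A T : T \subset A -> indep M T ->
  exists B : {set E}, [/\ T \subset B, B \subset A, indep M B & rank A = #|B|%:R].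
Proof.
move=> TA iT.
have [|B /maxsetP[/andP[BA iB] maxB] TB] :=
  @maxset_exists _ (fun B : {set E} => (B \subset A) && indep M B) T.
  by rewrite TA.
exists B; split=> //; apply/eqP; rewrite eq_le; apply/andP; split; last first.
  by rewrite -sumr_const; exact: (le_weighted_rank (fun=> 1)).
have [T0 [T0A iT0 rA]] := weighted_rank_attained A (fun=> ler01).
rewrite /matroid_rank rA sumr_const ler_nat leqNgt; apply/negP => /(indep_augment iB iT0)[e].
rewrite inE => /andP[eB eT0] ieB.
have /maxB : (e |: B \subset A) && indep M (e |: B).
  by rewrite ieB finset.subUset finset.sub1set BA (fintype.subsetP T0A).
by move=> /(_ (finset.subsetUr _ _)) /setP /(_ e); rewrite finset.setU11 (negbTE eB).
Qed.

(** Greedy property: an optimal set for [v], which may be taken inside [A],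
    extends to a set of maximal size in [S :&: A] and loses no [v]-weight, so
    the two summands are maximized simultaneously. *)
Lemma weighted_rank_peel v A (m : R) S :
  0 <= m -> (forall i, 0 <= v i) -> (forall i, i \notin A -> v i = 0) ->
  weighted_rank M (fun i => v i + m * (i \in A)%:R) S =
  weighted_rank M v S + m * rank (S :&: A).
Proof.
move=> m0 v0 vA.
have sumE (T : {set E}) : \sum_(i in T) (v i + m * (i \in A)%:R) =
    \sum_(i in T) v i + m * #|T :&: A|%:R.
  rewrite big_split -mulr_sumr; congr (_ + m * _).
  rewrite -sumr_const [RHS]big_mkcond [LHS]big_mkcond.
  by apply: eq_bigr => i _; rewrite inE; case: (i \in T); case: (i \in A).
apply/eqP; rewrite eq_le; apply/andP; split.
  have [|T [TS iT ->]] := @weighted_rank_attained (fun i => v i + m * (i \in A)%:R) S.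
    by move=> i; rewrite addr_ge0 // mulr_ge0 // ler0n.
  rewrite sumE lerD ?le_weighted_rank // ler_wpM2l // -sumr_const.
  apply: (le_weighted_rank (fun=> 1)); first exact: finset.setSI.
  exact: indepS (finset.subsetIl _ _) iT.
have [T [TS iT ->]] := weighted_rank_attained S v0.
have [||B [TB BSA iB ->]] := @indep_extend (S :&: A) (T :&: A).
- exact: finset.setSI.
- exact: indepS (finset.subsetIl _ _) iT.
have [BS BA] : B \subset S /\ B \subset A by apply/andP; rewrite -finset.subsetI.
apply: le_trans (le_weighted_rank _ BS iB).
rewrite sumE (finset.setIidPl BA) lerD2r.
rewrite [leLHS]big_mkcond [leRHS]big_mkcond; apply: ler_sum => i _.
case: ifP => iT'; last by case: ifP.
case: ifPn => // iB'; rewrite vA //; apply: contra iB' => iA.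
by rewrite (fintype.subsetP TB) // inE iT'.
Qed.

Lemma weighted_rank_zero w S : (forall i, w i = 0) -> weighted_rank M w S = 0.
Proof.
move=> w0; have [|T [_ _ ->]] := @weighted_rank_attained w S.
  by move=> i; rewrite w0.
by apply: big1 => i _.
Qed.

Lemma eq_weighted_rank w v S : w =1 v -> weighted_rank M w S = weighted_rank M v S.
Proof. by move=> wv; apply: eq_bigr => T _; apply: eq_bigr => i _. Qed.

(** Peeling at the least positive weight removes at least its minimizer from the
    support, so induction on the size of the support reaches [w = 0]. *)
Lemma gap_weighted_rank w x : (forall i, 0 <= w i) -> unit_cube x ->
  correlation_gap rank * concave_ext (weighted_rank M w) x
  <= multilinear_ext (weighted_rank M w) x.
Proof.
have rank_ge0 : forall S, 0 <= rank S by exact: weighted_rank_ge0.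
have cg0 := correlation_gap_ge0 rank_ge0.
move=> w0 x01; have [n] := ubnP #|[set i | w i != 0]%SET|.
elim: n w w0 => // n IH w w0; rewrite ltnS => le_n.
set A := [set i | w i != 0]%SET in le_n.
have memA i : (i \in A) = (w i != 0) by rewrite inE.
have [A0|[i0 i0A]] := set_0Vmem A.
  have wz i : w i = 0.
    by apply/eqP; have := finset.in_set0 i; rewrite -A0 memA => /negbFE.
  have F0 : 0 <= multilinear_ext (weighted_rank M w) x.
    by apply: multilinear_ext_ge0 => // S; exact: weighted_rank_ge0.
  apply: le_trans F0; rewrite mulr_ge0_le0 //.
  apply: concave_ext_le => // lam _.
  by rewrite big1 // => S _; rewrite weighted_rank_zero ?mulr0.
have [j jA min_j] := arg_minP w i0A; have {}jA : j \in A by [].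
set m := w j in min_j; pose v i := w i - m * (i \in A)%:R.
have vA i : i \notin A -> v i = 0.
  move=> iA; rewrite /v (negbTE iA) mulr0 subr0.
  by move: iA; rewrite memA negbK => /eqP.
have v0 i : 0 <= v i.
  have [iA|/vA -> //] := boolP (i \in A).
  by rewrite /v iA mulr1 subr_ge0 min_j.
have m0 : 0 <= m by exact: w0.
have wE : weighted_rank M w =
    fun S => weighted_rank M v S + m * rank (S :&: A).
  apply/funext => S; rewrite -weighted_rank_peel //.
  by apply: eq_weighted_rank => i; rewrite subrK.
have fhat_le : concave_ext (weighted_rank M w) x <=
    concave_ext (weighted_rank M v) x + m * concave_ext rank (restrict A x).
  rewrite wE; apply: le_trans (concave_extD_le _ _ x01) _.
  rewrite lerD2l; apply: le_trans (concave_extZ_le _ x01 m0) _.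
  by rewrite ler_wpM2l // concave_ext_setI_le.
apply: le_trans (ler_wpM2l cg0 fhat_le) _.
rewrite wE multilinear_extD multilinear_extZ multilinear_ext_setI.
rewrite mulrDr lerD //.
  apply: IH => //; apply: leq_trans le_n; apply: proper_card.
  apply/properP; split.
    by apply/fintype.subsetP => i; rewrite inE; apply: contraR => /vA ->.
  by exists j => //; rewrite inE /v jA mulr1 subrr eqxx.
rewrite mulrCA ler_wpM2l // correlation_gap_mul_le //.
exact: restrict_unit_cube.
Qed.

End Extensions.

Theorem theorem1p3 (R : realType) (E : finType) (M : matroid E) :
  inf [set correlation_gap (weighted_rank M w) | w in nonneg_weights R E]
  = correlation_gap (matroid_rank R M).
Proof.
have rank1 : nonneg_weights R E (fun=> 1) by move=> i; exact: ler01.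
apply/eqP; rewrite eq_le; apply/andP; split.
  apply: ge_inf; last by exists (fun=> 1).
  exists 0 => _ [w _ <-]; apply: correlation_gap_ge0 => S.
  exact: weighted_rank_ge0.
apply: lb_le_inf; first by eexists; exists (fun=> 1).
move=> _ [w w0 <-]; apply: le_correlation_gap => [S||x x01].
- exact: weighted_rank_ge0.
- by apply: correlation_gap_le1 => S; exact: weighted_rank_ge0.
- exact: gap_weighted_rank.
Qed.
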